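(* For every ribbon $a$ with $n$ nodes, $\gamma(a)\le\frac{n}{2}+1$.
   Context: $\mathbb{B}^2$ is the closed unit disk in $\mathbb{R}^2$ and $\mathbb{S}^1$ its boundary circle. A ribbon is a pair $a=(\varphi,\nu)$, where $\varphi:\mathbb{S}^1\to\mathbb{R}$ is a $C^\infty$ Morse function (finitely many critical points, all nondegenerate, hence all local extrema) with pairwise distinct critical values, and $\nu$ assigns to each critical point $p_1,\dots,p_n$ of $\varphi$ (called the nodes of $a$; $n$ is even) a sign $\nu(p_i)\in\{-1,+1\}$. An extension of $a$ is a $C^\infty$ function $f:\mathbb{B}^2\to\mathbb{R}$ with $f|_{\mathbb{S}^1}=\varphi$ such that at every node $p$ one has $\operatorname{sign}\langle\nabla f(p),p\rangle=\nu(p)$ if $p$ is a local maximum of $\varphi$ and $\operatorname{sign}\langle\nabla f(p),p\rangle=-\nu(p)$ if $p$ is a local minimum of $\varphi$. $\mathcal{F}(a)$ denotes the set of extensions of $a$. $\gamma(a)$ is the minimal number of critical points of $f$, over all $f\in\mathcal{F}(a)$. *)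

(* Defs.v *)
From mathcomp Require Import all_boot all_order all_algebra finmap.
From mathcomp Require Import all_classical all_reals all_analysis.

Set Implicit Arguments.
Unset Strict Implicit.
Unset Printing Implicit Defensive.

Import Order.TTheory GRing.Theory Num.Theory numFieldNormedType.Exports.

Local Open Scope classical_set_scope.
Local Open Scope ring_scope.

(* Meant for open U, where the directional derivatives at the points of U
   do not depend on the values of f outside U. *)
Fixpoint of_classC (R : realType) (V W : normedModType R) (k : nat)
    (U : set V) (f : V -> W) : Prop :=
  match k with
  | 0 => forall x, U x -> {for x, continuous f}
  | k'.+1 => (forall x, U x -> differentiable f x) /\
             (forall v, of_classC k' U ('D_v f))
  end.

Definition smooth (R : realType) (V W : normedModType R)
    (U : set V) (f : V -> W) : Prop :=
  forall k, of_classC k U f.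

(* A function on a closed set (such as the closed disk) is smooth when it is
   the restriction of a smooth function on an open neighbourhood. *)
Definition smooth_near (R : realType) (V W : normedModType R)
    (A : set V) (f : V -> W) : Prop :=
  exists U : set V, [/\ open U, A `<=` U & smooth U f].

Section Plane.
Variable R : realType.
Local Notation plane := 'rV[R]_2.

(* The norm of the library on row vectors is the sup norm, hence the explicit
   Euclidean inner product. *)
Definition dot (u v : plane) : R := \sum_i u 0 i * v 0 i.

Definition disk : set plane := [set x | dot x x <= 1].

Definition circle : set plane := [set x | dot x x = 1].

Definition grad (f : plane -> R) (p : plane) : plane :=
  \row_i 'D_(delta_mx 0 i) f p.

Definition circle_pt (t : R) : plane :=
  \row_i (if i == 0 then cos t else sin t).

(* Only the values of phi on the circle matter; its smoothness, critical points
   and their nondegeneracy are read in the angular coordinate, which is a local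
   chart of the circle around each point. *)
Definition angular (phi : plane -> R) : R -> R := phi \o circle_pt.

Definition circle_crit (phi : plane -> R) : set plane :=
  [set circle_pt t | t in [set t : R | derive1 (angular phi) t = 0]].

Definition is_morse (phi : plane -> R) : Prop :=
  [/\ smooth [set: R] (angular phi),
      finite_set (circle_crit phi) &
      forall t, derive1 (angular phi) t = 0 -> derive1n 2 (angular phi) t != 0].

Definition circle_locmax (phi : plane -> R) (p : plane) : Prop :=
  \forall q \near p, circle q -> phi q <= phi p.

Definition circle_locmin (phi : plane -> R) (p : plane) : Prop :=
  \forall q \near p, circle q -> phi p <= phi q.

(* The values of ribbon_fun off the circle and those of ribbon_sign off the
   nodes are irrelevant. *)
Record ribbon := Ribbon {
  ribbon_fun : plane -> R;
  ribbon_sign : plane -> int;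
  ribbon_morse : is_morse ribbon_fun;
  ribbon_distinct : forall p q,
    circle_crit ribbon_fun p -> circle_crit ribbon_fun q ->
    ribbon_fun p = ribbon_fun q -> p = q;
  ribbon_signP : forall p, circle_crit ribbon_fun p ->
    ribbon_sign p = 1 \/ ribbon_sign p = -1 }.

Definition nodes (a : ribbon) : set plane := circle_crit (ribbon_fun a).

Definition num_nodes (a : ribbon) : nat := #|` fset_set (nodes a)|%fset.

Definition is_extension (a : ribbon) (f : plane -> R) : Prop :=
  [/\ smooth_near disk f,
      forall p, circle p -> f p = ribbon_fun a p,
      forall p, nodes a p -> circle_locmax (ribbon_fun a) p ->
        sgz (dot (grad f p) p) = ribbon_sign a p &
      forall p, nodes a p -> circle_locmin (ribbon_fun a) p ->
        sgz (dot (grad f p) p) = - ribbon_sign a p].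

Definition crit (f : plane -> R) : set plane :=
  [set p | disk p /\ grad f p = 0].

Definition num_crit (f : plane -> R) : \bar R :=
  if pselect (finite_set (crit f)) then (#|` fset_set (crit f)|%fset)%:R%:E
  else +oo%E.

(* The values lie in nat together with +oo, so the infimum is a minimum; it is
   +oo if there is no extension with finitely many critical points. *)
Definition gamma (a : ribbon) : \bar R :=
  ereal_inf [set num_crit f | f in is_extension a].

End Plane.

(* Main.v *)
Require Import Defs.
From HB Require Import structures.
From mathcomp Require Import all_boot all_order all_algebra finmap.
From mathcomp Require Import all_classical all_reals all_analysis.
From mathcomp Require Import ring lra.

(* The data prescribe phi on the circle and, independently at each node, the
   sign of the radial derivative. It suffices to find an extension with at most
   1 + |S| critical points, where S is the set of nodes with negative radial
   derivative: the same construction applied to - phi exchanges S with its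
   complement in the set of nodes, and one of the two has at most n/2 elements.

   Since the critical values are distinct there is a polynomial P with
   P(phi p) = 1 for p in S and P(phi p) = 0 at the other nodes. With s = |x|^2,
   a constant c >= sup |phi| and N large, take in polar coordinates
     f = G(s) (phi(t) + c + b(s) P(phi(t))) + s - 1 - c,
     G(s) = exp(1 - 1/s) / s,   b(s) = (2/N) (1 - s^N).
   G is flat at 0, so f is smooth. The angular derivative is
   G phi' (1 + b P'(phi)), whose last factor is positive as b is small; hence
   critical points other than 0 lie on the rays through the nodes. On a ray with
   P = 0 the derivative in s is positive; on a ray with P = 1 it is -1 at s = 1
   and, as phi + c >= 0, its quotient by G is strictly decreasing on ]0, 1], so
   it vanishes at most once. *)

Set Implicit Arguments.
Unset Strict Implicit.
Unset Printing Implicit Defensive.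

Import Order.TTheory GRing.Theory Num.Theory numFieldNormedType.Exports.

Local Open Scope classical_set_scope.
Local Open Scope ring_scope.

(** * Calculus of differentials and closure properties of smooth functions *)

Section Differentiation.
Variables (R : realType) (V : normedModType R).
Implicit Types (f g : V -> R) (x v : V) (k : nat).

(** A linear map realizing the first-order expansion is the differential, by uniqueness. This form
    serves at the origin, where the chain rule through polar coordinates breaks down. *)
Lemma is_diff_bound (W : normedModType R) (f : V -> W) x
    (df : {linear V -> W}) : continuous df ->
  (forall e : R, 0 < e ->
     \forall h \near (0 : V), `|f (h + x) - f x - df h| <= e * `|h|) ->
  is_diff x f df.
Proof.
move=> cdf H.
have E : f \o shift x = cst (f x) + df +o_ (0 : V) id.
  apply/eqaddoP => _/posnumP[e].
  have := H e%:num ltac:(by []); apply: filterS => h /=.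
  by rewrite opprD addrA.
have D := diff_unique cdf E.
split=> //; apply/diff_locallyP; rewrite D; split=> //.
Qed.

Lemma is_diff_near (W : normedModType R) (f g : V -> W) x df :
  (\forall y \near x, f y = g y) -> is_diff x f df -> is_diff x g df.
Proof.
move=> fg [dfx <-]; apply: is_diff_bound; first exact: diff_continuous.
move=> e e0; have /diff_locally /eqaddoP /(_ e e0) := dfx.
apply: filter_app.
have : \forall h \near (0 : V), f (h + x) = g (h + x).
  by move: (fg); rewrite (near_shift 0) subr0.
apply: filterS => h /= fgh.
by rewrite opprD addrA -(nbhs_singleton fg) -fgh.
Qed.

Lemma is_diff_eqd f df dg x :
  is_diff x f df -> (forall v, df v = dg v) -> is_diff x f dg.
Proof. by move=> fdf /funext <-. Qed.

Lemma is_diff_add f g x df dg : is_diff x f df -> is_diff x g dg ->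
  is_diff x (fun y => f y + g y) (fun v => df v + dg v).
Proof. by move=> *; exact: is_diffD. Qed.

Lemma is_diff_mul f g x df dg : is_diff x f df -> is_diff x g dg ->
  is_diff x (fun y => f y * g y) (fun v => f x * dg v + g x * df v).
Proof. by move=> *; exact: is_diffM. Qed.

Lemma is_diff_const (c : R) x : is_diff x (fun=> c) (fun=> 0).
Proof. exact: is_diff_cst. Qed.

Lemma is_diff_comp1 (h : R -> R) f x df (dh : R) :
  is_diff x f df -> is_derive (f x) 1 h dh ->
  is_diff x (fun y => h (f y)) (fun v => dh * df v).
Proof.
move=> dfx [hx hE].
have dhx : is_diff (f x) h (fun t => t * dh).
  have hd : differentiable h (f x) by apply/derivable1_diffP.
  split=> //; rewrite diff1E//; apply/funext => t.
  by rewrite derive1E hE.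
have D : is_diff x (h \o f) ((fun t => t * dh) \o df) by exact: is_diff_comp.
rewrite (_ : (fun v => dh * df v) = (fun t => t * dh) \o df)//.
by apply/funext => v /=; exact: mulrC.
Qed.

Lemma is_diff_derive (W : normedModType R) (f : V -> W) x df v :
  is_diff x f df -> 'D_v f x = df v.
Proof. by case=> d E; rewrite deriveE// E. Qed.

Lemma of_classC_continuous (W : normedModType R) k (f : V -> W) (x : V) :
  of_classC k setT f -> {for x, continuous f}.
Proof.
case: k => [|k] /=; first exact.
by case=> /(_ x I) fx _; exact: differentiable_continuous.
Qed.

Lemma of_classCW (W : normedModType R) k (f : V -> W) :
  of_classC k.+1 setT f -> of_classC k setT f.
Proof.
elim: k f => [|k IH] f fk; first by move=> x _; exact: of_classC_continuous fk.
by case: fk => fd fv; split=> // v; exact: IH.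
Qed.

(** Gains one order of regularity from an explicit formula for the differential; all inductions on
    [k] below go through it. *)
Lemma of_classCS (W : normedModType R) k (f : V -> W) (df : V -> V -> W) :
  (forall x, is_diff x f (df x)) ->
  (forall v, of_classC k setT (fun x => df x v)) -> of_classC k.+1 setT f.
Proof.
move=> dfP dfk; split=> [x _|v]; first exact: ex_diff.
rewrite (_ : 'D_v f = fun x => df x v)//; apply/funext => x.
exact: is_diff_derive.
Qed.

Lemma of_classC_is_diff k f : of_classC k.+1 setT f ->
  forall x, is_diff x f (fun v => 'D_v f x).
Proof.
move=> [fd _] x; split; first exact: fd.
by apply/funext => v; rewrite deriveE//; exact: fd.
Qed.

Lemma of_classC_cst k (c : R) : of_classC k setT (fun _ : V => c).
Proof.
elim: k c => [|k IH] c; first by move=> x _; exact: cst_continuous.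
by apply: (@of_classCS R _ _ (fun _ _ => 0)) => // x; exact: is_diff_const.
Qed.

Lemma of_classCD k f g : of_classC k setT f -> of_classC k setT g ->
  of_classC k setT (fun x => f x + g x).
Proof.
elim: k f g => [|k IH] f g fk gk.
  by move=> x _; apply: continuousD; [exact: fk|exact: gk].
have df := of_classC_is_diff fk; have dg := of_classC_is_diff gk.
apply: (of_classCS (fun x => is_diff_add (df x) (dg x))) => v.
by apply: IH; [exact: (proj2 fk v)|exact: (proj2 gk v)].
Qed.

Lemma of_classCM k f g : of_classC k setT f -> of_classC k setT g ->
  of_classC k setT (fun x => f x * g x).
Proof.
elim: k f g => [|k IH] f g fk gk.
  by move=> x _; apply: continuousM; [exact: fk|exact: gk].
have df := of_classC_is_diff fk; have dg := of_classC_is_diff gk.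
apply: (of_classCS (fun x => is_diff_mul (df x) (dg x))) => v.
apply: of_classCD; apply: IH; [exact: of_classCW|exact: (proj2 gk v)|
  exact: of_classCW|exact: (proj2 fk v)].
Qed.

Lemma smooth_cst (c : R) : smooth setT (fun _ : V => c).
Proof. by move=> k; exact: of_classC_cst. Qed.

Lemma smoothD f g : smooth setT f -> smooth setT g ->
  smooth setT (fun x => f x + g x).
Proof. by move=> fs gs k; exact: of_classCD. Qed.

Lemma smoothM f g : smooth setT f -> smooth setT g ->
  smooth setT (fun x => f x * g x).
Proof. by move=> fs gs k; exact: of_classCM. Qed.

Lemma smoothN f : smooth setT f -> smooth setT (fun x => - f x).
Proof.
move=> fs; rewrite (_ : (fun _ => _) = fun x => -1 * f x).
  by apply: smoothM => //; exact: smooth_cst.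
by apply: funext => x; rewrite mulN1r.
Qed.

Lemma smoothX f n : smooth setT f -> smooth setT (fun x => f x ^+ n).
Proof.
move=> fs; elim: n => [|n IH]; first exact: smooth_cst.
rewrite (_ : (fun _ => _) = fun x => f x * f x ^+ n); first exact: smoothM.
by apply/funext => x; rewrite exprS.
Qed.

Lemma smooth_horner (p : {poly R}) f : smooth setT f ->
  smooth setT (fun x => p.[f x]).
Proof.
move=> fs; elim/poly_ind: p => [|p c IH].
  rewrite (_ : (fun _ => _) = fun=> 0); first exact: smooth_cst.
  by apply/funext => x; rewrite horner0.
rewrite (_ : (fun _ => _) = fun x => p.[f x] * f x + c); last first.
  by apply/funext => x; rewrite hornerMXaddC.
by apply: smoothD; [exact: smoothM|exact: smooth_cst].
Qed.

Lemma smooth_derive f v : smooth setT f -> smooth setT ('D_v f).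
Proof. by move=> fs k; exact: (proj2 (fs k.+1) v). Qed.

End Differentiation.

(** * Polar coordinates in the plane *)

Section PlaneGeometry.
Variable R : realType.
Local Notation plane := 'rV[R]_2.
Implicit Types (x v p : plane) (t s : R).

Lemma dotE x v : dot x v = x 0 0 * v 0 0 + x 0 1 * v 0 1.
Proof.
rewrite /dot !big_ord_recl big_ord0 addr0.
by congr (_ + _ * _); congr (_ _ _); apply/val_inj.
Qed.

(** The determinant of two plane vectors; [cross x v / dot x x] is the differential of the polar
    angle at [x]. *)
Definition cross x v : R := x 0 0 * v 0 1 - x 0 1 * v 0 0.

Definition rot90 x : plane := \row_i (if i == 0 then - x 0 1 else x 0 0).

Lemma circle_pt0 t : circle_pt t 0 0 = cos t.
Proof. by rewrite mxE. Qed.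

Lemma circle_pt1 t : circle_pt t 0 1 = sin t.
Proof. by rewrite mxE. Qed.

Lemma plane_eqP x v : x 0 0 = v 0 0 -> x 0 1 = v 0 1 -> x = v.
Proof.
move=> e0 e1; apply/rowP => i.
have [->//|->//] : i = 0 \/ i = 1.
by case: i => [[|[|//]] h]; [left|right]; apply/val_inj.
Qed.

Lemma dot_ge0 x : 0 <= dot x x.
Proof. by rewrite dotE -!expr2 addr_ge0// sqr_ge0. Qed.

Lemma dot_eq0 x : (dot x x == 0) = (x == 0).
Proof.
apply/idP/eqP => [|->]; last by rewrite dotE !mxE !mul0r addr0.
rewrite dotE -!expr2 paddr_eq0 ?sqr_ge0// !sqrf_eq0 => /andP[/eqP h0 /eqP h1].
by apply: plane_eqP; rewrite ?h0 ?h1 mxE.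
Qed.

Lemma dot_gt0 x : x != 0 -> 0 < dot x x.
Proof. by move=> x0; rewrite lt_def dot_eq0 x0 dot_ge0. Qed.

Lemma circle_pt_circle t : circle (circle_pt t).
Proof. by rewrite /circle /= dotE circle_pt0 circle_pt1 -!expr2 cos2Dsin2. Qed.

Lemma dotZ a x : dot (a *: x) (a *: x) = a ^+ 2 * dot x x.
Proof. by rewrite !dotE !mxE; ring. Qed.

Lemma circle_pt_onto x : circle x ->
  exists2 t, - pi <= t <= pi & circle_pt t = x.
Proof.
rewrite /circle /= dotE -!expr2 => x1.
have c1 : -1 <= x 0 0 <= 1.
  rewrite -ler_norml -(@ler_pXn2r _ 2)// ?nnegrE// ?normr_ge0//.
  by rewrite real_normK ?num_real// expr1n -x1 lerDl sqr_ge0.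
have cE : cos (acos (x 0 0)) = x 0 0 by rewrite acosK// in_itv.
have sE : sin (acos (x 0 0)) = `|x 0 1|.
  by rewrite sin_acos// -x1 addrC addKr sqrtr_sqr.
have a0 := acos_ge0 c1; have api := acos_lepi c1.
have [x1_ge0|x1_lt0] := leP 0 (x 0 1).
  exists (acos (x 0 0)).
    by rewrite api andbT (le_trans _ a0)// oppr_le0 pi_ge0.
  by apply: plane_eqP; rewrite ?circle_pt0 ?circle_pt1// sE ger0_norm.
exists (- acos (x 0 0)).
  by rewrite lerNl opprK api/= (le_trans _ (pi_ge0 R))// oppr_le0.
by apply: plane_eqP; rewrite ?circle_pt0 ?circle_pt1 ?cosN// sinN sE ltr0_norm
  ?opprK.
Qed.

Lemma polar_subproof x :
  exists t, - pi <= t <= pi /\ x = Num.sqrt (dot x x) *: circle_pt t.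
Proof.
have [->|x0] := eqVneq x 0.
  exists 0; split; first by rewrite oppr_le0 pi_ge0.
  by rewrite (eqP (_ : dot 0 0 == 0)) ?dot_eq0// sqrtr0 scale0r.
have d0 := dot_gt0 x0.
have s0 : Num.sqrt (dot x x) != 0 by rewrite gt_eqF// sqrtr_gt0.
have [t tpi tE] : exists2 t, - pi <= t <= pi &
    circle_pt t = (Num.sqrt (dot x x))^-1 *: x.
  apply: circle_pt_onto; rewrite /circle /= dotZ exprVn sqr_sqrtr ?dot_ge0//.
  by rewrite mulVf// gt_eqF.
by exists t; split=> //; rewrite tE scalerA mulfV// scale1r.
Qed.

(** An angle obtained by choice: arbitrary at the origin, ambiguous on the negative half-axis, and
    with no continuity built in. *)
Definition arg x : R := sval (cid (polar_subproof x)).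

Lemma arg_itv x : - pi <= arg x <= pi.
Proof. by case: (svalP (cid (polar_subproof x))). Qed.

Lemma polarE x : x = Num.sqrt (dot x x) *: circle_pt (arg x).
Proof. by case: (svalP (cid (polar_subproof x))). Qed.

Lemma circle_pt_ray t t' a b : 0 < a -> 0 < b ->
  a *: circle_pt t = b *: circle_pt t' -> circle_pt t = circle_pt t'.
Proof.
move=> a0 b0 e.
have ab : a = b.
  apply/eqP; rewrite -(@eqrXn2 _ 2)// ?ltW//.
  have : dot (a *: circle_pt t) (a *: circle_pt t) =
         dot (b *: circle_pt t') (b *: circle_pt t') by rewrite e.
  by rewrite !dotZ !circle_pt_circle !mulr1 => ->.
move: e; rewrite ab => /(congr1 (fun z => b^-1 *: z)).
by rewrite !scalerA mulVf ?gt_eqF// !scale1r.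
Qed.

Lemma arg_circle x : circle x -> circle_pt (arg x) = x.
Proof. by move=> cx; rewrite [RHS]polarE cx sqrtr1 scale1r. Qed.

End PlaneGeometry.

(** * Periodic functions of the polar angle *)

Section Angular.
Variable R : realType.
Local Notation plane := 'rV[R]_2.
Implicit Types (x v p : plane) (t s : R) (g : R -> R).

Lemma is_diff_coord (i : 'I_2) x :
  is_diff x (fun y : plane => y 0 i) (fun v => v 0 i).
Proof.
have lin : linear (fun y : plane => y 0 i) by move=> a u v; rewrite !mxE.
pose L := GRing.isLinear.Build R plane R _ _ lin.
pose F : {linear plane -> R} := HB.pack (fun y : plane => y 0 i) L.
have cF : continuous F by exact: coord_continuous.
by split; [exact: differentiable_coord | exact: (@diff_lin _ _ _ F x cF)].
Qed.

Lemma is_diff_cross p x : is_diff x (cross p) (cross p).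
Proof.
rewrite (_ : cross p = fun y => p 0 0 * y 0 1 + (- p 0 1) * y 0 0); last first.
  by apply/funext => y; rewrite /cross mulNr.
apply: is_diff_eqd (is_diff_add
  (is_diff_mul (is_diff_const _ _) (is_diff_coord _ _))
  (is_diff_mul (is_diff_const _ _) (is_diff_coord _ _))) _ => v.
by rewrite !mulr0 !addr0.
Qed.

Lemma is_diff_dot p x : is_diff x (dot p) (dot p).
Proof.
rewrite (_ : dot p = fun y => p 0 0 * y 0 0 + p 0 1 * y 0 1); last first.
  by apply/funext => y; rewrite dotE.
apply: is_diff_eqd (is_diff_add
  (is_diff_mul (is_diff_const _ _) (is_diff_coord _ _))
  (is_diff_mul (is_diff_const _ _) (is_diff_coord _ _))) _ => v.
by rewrite !mulr0 !addr0.
Qed.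

Lemma is_diff_sq x : is_diff x (fun y => dot y y) (fun v => 2 * dot x v).
Proof.
have -> : (fun y : plane => dot y y) =
    fun y => y 0 0 * y 0 0 + y 0 1 * y 0 1.
  by apply/funext => y; rewrite dotE.
apply: is_diff_eqd (is_diff_add
  (is_diff_mul (is_diff_coord _ _) (is_diff_coord _ _))
  (is_diff_mul (is_diff_coord _ _) (is_diff_coord _ _))) _ => v.
by rewrite dotE; ring.
Qed.

Lemma of_classC_coord k (i : 'I_2) : of_classC k setT (fun y : plane => y 0 i).
Proof.
case: k => [|k]; first by move=> x _; exact: coord_continuous.
apply: of_classCS (fun x => is_diff_coord i x) _ => v; exact: of_classC_cst.
Qed.

Lemma smooth_dot p : smooth setT (dot p).
Proof.
rewrite (_ : dot p = fun y => p 0 0 * y 0 0 + p 0 1 * y 0 1); last first.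
  by apply/funext => y; rewrite dotE.
by apply: smoothD; apply: smoothM; try exact: smooth_cst;
  move=> k; exact: of_classC_coord.
Qed.

Lemma smooth_cross p : smooth setT (cross p).
Proof.
rewrite (_ : cross p = fun y => p 0 0 * y 0 1 + (- p 0 1) * y 0 0); last first.
  by apply/funext => y; rewrite /cross mulNr.
by apply: smoothD; apply: smoothM; try exact: smooth_cst;
  move=> k; exact: of_classC_coord.
Qed.

Lemma smooth_sq : smooth setT (fun y : plane => dot y y).
Proof.
have -> : (fun y : plane => dot y y) =
    fun y => y 0 0 * y 0 0 + y 0 1 * y 0 1.
  by apply/funext => y; rewrite dotE.
by apply: smoothD; apply: smoothM; move=> k; exact: of_classC_coord.
Qed.

Lemma crossC p x : cross p x = - cross x p.
Proof. by rewrite /cross; ring. Qed.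

(** Periodicity, stated as descent to the circle, so that [g (arg x)] for [x] nonzero does not
    depend on the angle chosen by [arg]. *)
Definition circular g := forall t t', circle_pt t = circle_pt t' -> g t = g t'.

Lemma circle_ptD t t' u : circle_pt t = circle_pt t' ->
  circle_pt (u + t) = circle_pt (u + t').
Proof.
move=> e; have c := congr1 (fun z : plane => z 0 0) e.
have s := congr1 (fun z : plane => z 0 1) e.
rewrite /= !circle_pt0 in c; rewrite /= !circle_pt1 in s.
by apply: plane_eqP; rewrite ?circle_pt0 ?circle_pt1 ?cosD ?sinD c s.
Qed.

Lemma circular_derive g : circular g -> circular (derive1 g).
Proof.
move=> gc t t' e; rewrite /derive1.
suff -> : (fun h => h^-1 *: (g (h + t) - g t)) =
  (fun h => h^-1 *: (g (h + t') - g t')) by [].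
by apply: funext => h; rewrite (gc _ _ e) (gc _ _ (circle_ptD h e)).
Qed.

(** On the open half-plane facing [x], the angle from [x] to [y] has tangent [cross x y / dot x y].
    This yields a smooth local branch of the angle, whatever the jumps of [arg]. *)
Lemma circle_pt_arg_near x y : x != 0 -> 0 < dot x y ->
  circle_pt (arg y) = circle_pt (arg x + atan (cross x y / dot x y)).
Proof.
move=> x0 xy.
have y0 : y != 0.
  by apply: contraTneq xy => ->; rewrite dotE !mxE !mulr0 addr0 ltxx.
have ry : 0 < Num.sqrt (dot y y) by rewrite sqrtr_gt0 dot_gt0.
have rx : 0 < Num.sqrt (dot x x) by rewrite sqrtr_gt0 dot_gt0.
set a := atan _; set r := Num.sqrt (dot x x) in rx.
have ca : 0 < cos a.
  by rewrite cos_atan invr_gt0 sqrtr_gt0 ltr_pwDl// sqr_ge0.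
have ta : sin a = cos a * (cross x y / dot x y).
  by rewrite -[cross x y / _]atanK -/a /tan mulrCA mulfV ?mulr1// gt_eqF.
apply: (@circle_pt_ray _ _ _ (Num.sqrt (dot y y) * (cos a * r))
  (dot x y)) => //.
  by rewrite !mulr_gt0.
rewrite mulrC -scalerA -polarE.
have x0E : x 0 0 = r * cos (arg x).
  by rewrite [in LHS](polarE x) mxE circle_pt0.
have x1E : x 0 1 = r * sin (arg x).
  by rewrite [in LHS](polarE x) mxE circle_pt1.
have cs := cos2Dsin2 (arg x).
have dE : dot x y = r * (cos (arg x) * y 0 0 + sin (arg x) * y 0 1).
  by rewrite dotE x0E x1E; ring.
have cE : cross x y = r * (cos (arg x) * y 0 1 - sin (arg x) * y 0 0).
  by rewrite /cross x0E x1E; ring.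
have dca : dot x y * sin a = cos a * cross x y.
  by rewrite ta mulrCA [X in _ * X]mulrC divfK// gt_eqF.
apply: plane_eqP; rewrite !mxE /=.
  rewrite cosD mulrBr mulrCA [X in _ - X]mulrCA dca dE cE.
  transitivity
    (cos a * r * (y 0 0 * (cos (arg x) ^+ 2 + sin (arg x) ^+ 2))); last by ring.
  by rewrite cs mulr1.
rewrite sinD mulrDr mulrCA [X in _ + X]mulrCA dca dE cE.
transitivity
  (cos a * r * (y 0 1 * (cos (arg x) ^+ 2 + sin (arg x) ^+ 2))); last by ring.
by rewrite cs mulr1.
Qed.

(** Near [x], periodicity lets [arg] be replaced by the arctangent branch, which is differentiated
    by the chain rule; as [cross x x] is 0, the arctangent is taken at 0, where its derivative is
    1. *)
Lemma is_diff_arg g x : x != 0 -> circular g -> smooth setT g ->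
  is_diff x (fun y => g (arg y))
    (fun v => derive1 g (arg x) * (cross x v / dot x x)).
Proof.
move=> x0 gc gs.
have dx := dot_gt0 x0.
have cxx : cross x x = 0 by rewrite /cross; ring.
apply: (@is_diff_near _ _ _ (fun y => g (arg x + atan (cross x y / dot x y)))).
  have : \forall y \near x, 0 < dot x y.
    have /differentiable_continuous dc : differentiable (dot x) x.
      exact: (ex_diff (is_diff_def := is_diff_dot x x)).
    have : nbhs (dot x x) [set z : R | 0 < z].
      by apply: open_nbhs_nbhs; split; [exact: open_gt|].
    exact: dc.
  apply: filterS => y xy; apply/esym; apply: gc.
  exact: circle_pt_arg_near.
have dinv : is_derive (dot x x) 1 (fun z : R => z^-1) (- (dot x x) ^- 2 *: 1).
  have dx0 : dot x x != 0 by rewrite gt_eqF.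
  exact: (@is_deriveV R id (dot x x) 1 1 dx0 (is_derive_id _ _)).
have dq := is_diff_mul (is_diff_cross x x)
  (is_diff_comp1 (is_diff_dot x x) dinv).
have da : is_derive (cross x x / dot x x) 1 atan
    (1 + (cross x x / dot x x) ^+ 2)^-1.
  exact: is_derive1_atan.
have dg : is_derive (atan (cross x x / dot x x)) 1 (fun t => g (arg x + t))
    (derive1 g (arg x)).
  rewrite cxx mul0r atan0.
  have gd : derivable g (arg x) 1.
    by apply/derivable1_diffP; exact: (proj1 (gs 1%N) _ I).
  have E : (fun h : R => h^-1 *: (((fun t => g (arg x + t)) \o shift 0) (h *: 1)
        - g (arg x + 0))) =
      fun h : R => h^-1 *: ((g \o shift (arg x)) (h *: 1) - g (arg x)).
    by apply/funext => h /=; rewrite !addr0 [arg x + _]addrC.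
  rewrite derive1E; split; rewrite /derivable /derive E; [exact: gd|by []].
apply: is_diff_eqd (is_diff_comp1 (is_diff_comp1 dq da) dg) _ => v.
rewrite cxx !mul0r expr0n/= addr0 invr1 mul1r add0r.
by congr (_ * _); rewrite mulrC.
Qed.
End Angular.

(** * Functions flat at the origin *)

Section Flat.
Variable R : realType.
Local Notation plane := 'rV[R]_2.
Implicit Types (x v p : plane) (t s : R) (g : R -> R).

(* As 0^-1 = 0, [flat m] takes the value 0 at 0 only for m > 0. *)
Definition flat (m : nat) (s : R) : R := s^-1 ^+ m * expR (- s^-1).

Lemma is_derive_flat m s : s != 0 ->
  is_derive s 1 (flat m) (- m%:R * flat m.+1 s + flat m.+2 s).
Proof.
move=> s0.
have di : is_derive s 1 (fun y : R => y^-1) (- s ^- 2 *: 1).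
  exact: (@is_deriveV R id s 1 1 s0 (is_derive_id _ _)).
have dX : is_derive s 1 (fun y : R => y^-1 ^+ m)
    ((m%:R * s^-1 ^+ m.-1) *: (- s ^- 2 *: 1)).
  have -> : (fun y : R => y^-1 ^+ m) = (fun y : R => y^-1) ^+ m.
    by rewrite exprfctE.
  exact: (is_deriveX m di).
have dE : is_derive s 1 (fun y : R => expR (- y^-1))
    (expR (- s^-1) * - (- s ^- 2 *: 1)).
  exact: (is_derive1_comp (is_derive_expR _) (is_deriveN di)).
have G : is_derive s 1 (flat m)
   (s^-1 ^+ m *: (expR (- s^-1) * - (- s ^- 2 *: 1)) +
   expR (- s^-1) *: ((m%:R * s^-1 ^+ m.-1) *: (- s ^- 2 *: 1))).
  exact: is_deriveM dX dE.
apply: (is_derive_eq G).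
rewrite /flat /GRing.scale /= !mulr1 -!exprVn.
(* The power rule produces the exponent [m.-1], so [m = 0] is treated apart. *)
case: m {dX G} => [|m]; first by rewrite !expr0; ring.
by rewrite /= !exprS !expr0; ring.
Qed.

Lemma flat0 m : flat m.+1 0 = 0.
Proof. by rewrite /flat invr0 expr0n mul0r. Qed.

Lemma flat_ge0 m s : 0 <= s -> 0 <= flat m s.
Proof. by move=> s0; rewrite mulr_ge0 ?expR_ge0// exprn_ge0// invr_ge0. Qed.

(** The exponential of 1/s dominates the single term of degree m + 2 of its series. Taken at s =
    |x|^2, the bound is quadratic in |x|. *)
Lemma flat_le m s : 0 <= s -> flat m.+1 s <= m.+2`!%:R * s.
Proof.
rewrite le_eqVlt => /predU1P[<-|s0]; first by rewrite flat0 mulr0.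
have := @expR_ge1Dxn R s^-1 m.+1; rewrite invr_ge0 (ltW s0) => /(_ isT) H.
have F : 0 < m.+2`!%:R :> R by rewrite ltr0n fact_gt0.
have {}H : s^-1 ^+ m.+2 / m.+2`!%:R <= expR s^-1.
  by rewrite (le_trans _ H)// lerDr.
rewrite /flat expRN ler_pdivrMr ?expR_gt0//.
move: H; rewrite ler_pdivrMr// => /(ler_wpM2l (ltW s0)).
rewrite exprS mulrA mulfV ?gt_eqF// mul1r => /le_trans; apply.
rewrite le_eqVlt; apply/orP; left; apply/eqP.
ring.
Qed.

(** Every value is attained on the compact interval [- pi, pi], where the extreme value theorem
    applies. *)
Lemma circular_bounded g : circular g -> smooth setT g ->
  exists2 B : R, 0 <= B & forall t, `|g t| <= B.
Proof.
move=> gc gs.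
have gcont : {within `[- pi, pi : R], continuous (fun t => `|g t|)}.
  apply: continuous_subspaceT => t.
  by apply: continuous_comp; [exact: (gs 0%N)|exact: norm_continuous].
have pp : - pi <= pi :> R by rewrite (le_trans _ (pi_ge0 R))// oppr_le0 pi_ge0.
have [c _ cmax] := EVT_max pp gcont.
exists `|g c| => // t.
rewrite (gc t (arg (circle_pt t))) ?cmax ?in_itv ?arg_itv//.
by rewrite arg_circle//; exact: circle_pt_circle.
Qed.

Lemma dot_le_norm x : dot x x <= 2 * `|x| ^+ 2.
Proof.
have h i : x 0 i ^+ 2 <= `|x| ^+ 2.
  rewrite -real_normK ?num_real// lerXn2r ?nnegrE ?normr_ge0//.
  rewrite [ `|x| ]mx_normrE.
  exact: (le_bigmax _ (fun ij : 'I_1 * 'I_2 => `|x ij.1 ij.2|) (0, i)).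
by rewrite dotE -!expr2 mulr2n mulrDl mul1r lerD.
Qed.


(* Smooth because these functions vanish to second order at 0 and their partial
   derivatives are sums of functions of the same form. *)
Definition flat_term m g (Q : plane -> R) x : R :=
  Q x * (g (arg x) * flat m (dot x x)).

(** Away from 0 this is the product rule: one term from [Q], one from [g], and two from [flat]. At 0
    the quadratic bound forces the differential to vanish, as do the four terms. *)
Lemma is_diff_flat_term m g (Q : plane -> R) x :
  circular g -> smooth setT g -> smooth setT Q ->
  is_diff x (flat_term m.+1 g Q) (fun v =>
    flat_term m.+1 g ('D_v Q) x +
    (flat_term m.+2 (derive1 g) (fun y => Q y * cross y v) x +
    (flat_term m.+2 g (fun y => Q y * (- 2 * m.+1%:R * dot y v)) x +
     flat_term m.+3 g (fun y => Q y * (2 * dot y v)) x))).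
Proof.
move=> gc gs Qs.
have [->|x0] := eqVneq x 0.
  have d0 : dot 0 0 = 0 :> R by apply/eqP; rewrite dot_eq0.
  have [B B0 gB] := circular_bounded gc gs.
  have [B' B'0 Q0] : exists2 B', 0 < B' &
      \forall y \near (0 : plane), `|Q y| <= B'.
    exists (`|Q 0| + 1); first by rewrite ltr_wpDl.
    have Qc : {for (0 : plane), continuous Q} by exact: (Qs 0%N).
    have QB : \forall y \near (0 : plane), ball (Q 0) 1 (Q y).
      by apply: Qc; exact: nbhsx_ballx.
    apply: filterS QB => y /=; rewrite -ball_normE/= => /ltW h.
    rewrite -[Q y](subrK (Q 0)) addrC (le_trans (ler_normD _ _))// lerD2l.
    by rewrite distrC.
  have Z : is_diff (0 : plane) (flat_term m.+1 g Q) (\0 : {linear plane -> R}).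
    apply: is_diff_bound; first exact: cst_continuous.
    (* Near 0 the function is at most (K - 1) |h|^2 in absolute value; the added 1 keeps [K]
       positive, so that e / K makes sense. *)
    move=> e e0; pose K := B' * (B * (m.+2`!%:R * 2)) + 1.
    have K0 : 0 < K by rewrite ltr_wpDl// !mulr_ge0// ltW.
    have small : \forall h \near (0 : plane), `|h| < e / K.
      have HB : nbhs (0 : plane) (ball (0 : plane) (e / K)).
        by apply: nbhsx_ballx; rewrite divr_gt0.
      by apply: filterS HB => h; rewrite -ball_normE/= sub0r normrN.
    apply: filterS2 Q0 small => h Qh hK.
    rewrite addr0 [X in _ - X - _]/flat_term d0 flat0 !mulr0 !subr0.
    rewrite /flat_term normrM [X in _ * X]normrM.
    rewrite (ger0_norm (flat_ge0 _ (dot_ge0 _))).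
    have fh : flat m.+1 (dot h h) <= m.+2`!%:R * (2 * `|h| ^+ 2).
      rewrite (le_trans (flat_le _ (dot_ge0 _)))// ler_wpM2l//.
      exact: dot_le_norm.
    have : `|Q h| * (`|g (arg h)| * flat m.+1 (dot h h)) <=
           B' * (B * (m.+2`!%:R * (2 * `|h| ^+ 2))).
      have f0 := flat_ge0 m.+1 (dot_ge0 h).
      by apply: ler_pM => //; [exact: mulr_ge0|exact: ler_pM].
    move=> /le_trans; apply.
    have -> : B' * (B * (m.+2`!%:R * (2 * `|h| ^+ 2))) = (K - 1) * `|h| * `|h|.
      by rewrite /K; ring.
    rewrite ler_wpM2r// (@le_trans _ _ (K * `|h|))//.
      by rewrite ler_wpM2r// gerBl.
    by rewrite mulrC -ler_pdivlMr// ltW.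
  apply: is_diff_eqd Z _ => v.
  by rewrite /flat_term !d0 !flat0 !mulr0 !addr0.
have dx := dot_gt0 x0.
have dQ := of_classC_is_diff (Qs 1%N) x.
have dg := is_diff_arg x0 gc gs.
have df := is_diff_comp1 (is_diff_sq x) (is_derive_flat m.+1 (lt0r_neq0 dx)).
apply: is_diff_eqd (is_diff_mul dQ (is_diff_mul dg df)) _ => v.
rewrite /flat_term.
(* The division by |x|^2 in the differential of the angle is absorbed by raising the index of
   [flat]. *)
have fE k : flat k (dot x x) / dot x x = flat k.+1 (dot x x).
  by rewrite /flat exprS; ring.
rewrite -(fE m.+1); ring.
Qed.

Lemma smooth_flat_term m g (Q : plane -> R) :
  circular g -> smooth setT g -> smooth setT Q ->
  smooth setT (flat_term m.+1 g Q).
Proof.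
move=> gc gs Qs k.
(* All of [m], [g] and [Q] change under differentiation, so the induction generalizes them. *)
elim: k m g Q gc gs Qs => [|k IH] m g Q gc gs Qs.
  move=> x _; apply: differentiable_continuous.
  exact: (ex_diff (is_diff_def := is_diff_flat_term m x gc gs Qs)).
have g'c := circular_derive gc.
have g's : smooth setT (derive1 g).
  rewrite (_ : derive1 g = 'D_1 g); first exact: smooth_derive.
  by apply: funext => t; rewrite derive1E.
have crs v : smooth setT (fun y : plane => cross y v).
  rewrite (_ : (fun _ => _) = fun y => -1 * cross v y).
    by apply: smoothM; [exact: smooth_cst|exact: smooth_cross].
  by apply: funext => y; rewrite crossC mulN1r.
have dts v : smooth setT (fun y : plane => dot y v).
  rewrite (_ : (fun _ => _) = dot v); first exact: smooth_dot.
  by apply: funext => y; rewrite !dotE; ring.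
apply: (of_classCS (fun x => is_diff_flat_term m x gc gs Qs)) => v.
apply: of_classCD; [|apply: of_classCD; [|apply: of_classCD]]; apply: IH => //.
- exact: smooth_derive.
- exact: smoothM.
- by apply: smoothM => //; apply: smoothM => //; exact: smooth_cst.
- by apply: smoothM => //; apply: smoothM => //; exact: smooth_cst.
Qed.

End Flat.

(** * Polynomial interpolation *)

Section Interpolation.

(** Newton's scheme: each new point is fitted by adding a multiple of the polynomial that vanishes
    at the points already treated. *)
Lemma interpolation (F : fieldType) (s : seq F) (v : F -> F) : uniq s ->
  exists P : {poly F}, forall y, y \in s -> P.[y] = v y.
Proof.
elim: s => [|a s IH] /=; first by exists 0.
move=> /andP[as_ /IH[P PE]].
pose M := \prod_(z <- s) ('X - z%:P).
have Ma : M.[a] != 0 by rewrite -/(root M a) root_prod_XsubC.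
exists (P + ((v a - P.[a]) / M.[a])%:P * M) => y.
rewrite inE hornerD hornerM hornerC => /predU1P[->|ys].
  by rewrite divfK// addrC subrK.
have /rootP -> : root M y by rewrite root_prod_XsubC.
by rewrite mulr0 addr0 PE.
Qed.

End Interpolation.

(** * The radial profiles G and b, and monotonicity along a ray *)

Section RadialProfile.
Variable R : realType.
Implicit Types s t w : R.

(** The function G, expressed through [flat] so that its smoothness at the origin is inherited from
    [flat_term]. *)
Definition cutoff s : R := expR 1 * flat 1 s.

Lemma cutoffE s : cutoff s = s^-1 * expR (1 - s^-1).
Proof. by rewrite /cutoff /flat expr1 mulrCA -expRD. Qed.

Lemma cutoff1 : cutoff 1 = 1.
Proof. by rewrite cutoffE invr1 subrr expR0 mul1r. Qed.

Lemma cutoff_gt0 s : 0 < s -> 0 < cutoff s.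
Proof. by move=> s0; rewrite cutoffE mulr_gt0 ?expR_gt0 ?invr_gt0. Qed.

Lemma is_derive_cutoff s : s != 0 ->
  is_derive s 1 cutoff (cutoff s * ((1 - s) / s ^+ 2)).
Proof.
move=> s0.
have G : is_derive s 1 cutoff (expR 1 *: (- 1%:R * flat 2 s + flat 3 s)).
  exact: is_deriveZ (is_derive_flat 1 s0).
apply: (is_derive_eq G).
rewrite /cutoff /flat /GRing.scale/=; field.
exact: s0.
Qed.

(** The function b: the factor 2 / N keeps it uniformly small on [0, 1] while its derivative at 1
    remains -2 for every positive N. *)
Definition hump (N : nat) s : R := 2 / N%:R * (1 - s ^+ N).

Lemma is_derive_hump N s : (0 < N)%N ->
  is_derive s 1 (hump N) (- 2 * s ^+ N.-1).
Proof.
move=> N0; have Nn : N%:R != 0 :> R by rewrite pnatr_eq0 -lt0n.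
have dX : is_derive s 1 (fun y : R => y ^+ N) ((N%:R * s ^+ N.-1) *: 1).
  rewrite (_ : (fun _ => _) = (id : R -> R) ^+ N); last by rewrite exprfctE.
  exact: (is_deriveX N (is_derive_id s 1)).
have G : is_derive s 1 (hump N) ((2 / N%:R) *: (0 - (N%:R * s ^+ N.-1) *: 1)).
  exact: is_deriveZ (is_deriveB (is_derive_cst (1 : R) s 1) dX).
apply: (is_derive_eq G).
by rewrite /GRing.scale/=; field.
Qed.

Lemma hump1 N : hump N 1 = 0.
Proof. by rewrite /hump expr1n subrr mulr0. Qed.

Lemma hump_itv N s : 0 <= s <= 1 -> 0 <= hump N s <= 2 / N%:R.
Proof.
move=> /andP[s0 s1]; have h := exprn_ge0 N s0; have h1 := exprn_ile1 N s0 s1.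
have N0 : 0 <= 2 / N%:R :> R by rewrite divr_ge0.
by rewrite /hump mulr_ge0 ?subr_ge0//= ler_piMr// gerBl.
Qed.

Lemma hump_le N s t : 0 <= s -> s <= t -> hump N t <= hump N s.
Proof.
move=> s0 st; rewrite ler_wpM2l ?divr_ge0// lerD2l lerN2.
by rewrite lerXn2r// ?nnegrE// (le_trans s0).
Qed.

(* The derivative in s of the extension below on the ray of a node where P = 1
   and phi + c = w, divided by [cutoff s]. *)
Definition ray N w s : R :=
  (1 - s) / s ^+ 2 * (w + hump N s) - 2 * s ^+ N.-1 + (cutoff s)^-1.

(** The first summand is a product of nonnegative nonincreasing factors, the power term is strictly
    decreasing because N - 1 > 0, and 1 / G is nonincreasing on ]0, 1]. *)
Lemma ray_decr N w s t : (1 < N)%N -> 0 <= w -> 0 < s -> s < t -> t <= 1 ->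
  ray N w t < ray N w s.
Proof.
move=> N1 w0 s0 st t1; have t0 := lt_trans s0 st.
have s1 := le_trans (ltW st) t1.
have H1 : (1 - t) / t ^+ 2 * (w + hump N t) <=
    (1 - s) / s ^+ 2 * (w + hump N s).
  have t01 : 0 <= t <= 1 by rewrite (ltW t0).
  have /andP[bt _] := hump_itv N t01.
  apply: ler_pM.
  - by rewrite divr_ge0 ?subr_ge0// exprn_ge0// ltW.
  - by rewrite addr_ge0.
  - apply: ler_pM; rewrite ?subr_ge0 ?invr_ge0 ?exprn_ge0 ?(ltW t0)//.
      by rewrite lerD2l lerN2 ltW.
    by rewrite lef_pV2 ?posrE ?exprn_gt0// lerXn2r ?nnegrE// ltW.
  - by rewrite lerD2l hump_le// ltW.
have H2 : 2 * s ^+ N.-1 < 2 * t ^+ N.-1.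
  rewrite ltr_pM2l// ltrXn2r// ?nnegrE ?ltW//.
  by case: N N1 {H1} => [|[]].
have H3 : (cutoff t)^-1 <= (cutoff s)^-1.
  rewrite lef_pV2 ?posrE ?cutoff_gt0// !cutoffE.
  have -> : 1 - t^-1 = (1 - s^-1) + (s^-1 - t^-1) by ring.
  rewrite [in leRHS]expRD [leRHS]mulrCA mulrC ler_pM2l ?expR_gt0//.
  (* With exp u >= 1 + u for u = 1/s - 1/t, the claim reduces to the sign of (t - s) (1 - t). *)
  have := expR_ge1Dx (s^-1 - t^-1); move=> /(@ler_wpM2l _ t^-1) h.
  apply: le_trans (h _); last by rewrite invr_ge0 ltW.
  rewrite -subr_ge0.
  have -> : t^-1 * (1 + (s^-1 - t^-1)) - s^-1 =
      (t - s) * (1 - t) / (s * t ^+ 2).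
    by field; rewrite !gt_eqF.
  rewrite divr_ge0 ?mulr_ge0 ?subr_ge0 ?exprn_ge0// ltW//.
rewrite /ray; lra.
Qed.

End RadialProfile.

(** * The extension and its critical points *)

Section Extension.
Variable R : realType.
Local Notation plane := 'rV[R]_2.
Implicit Types (x v p : plane).

Lemma dot_grad (f : plane -> R) x v :
  differentiable f x -> dot (grad f x) v = 'D_v f x.
Proof.
move=> fx.
have vE : v = v 0 0 *: delta_mx 0 0 + v 0 1 *: delta_mx 0 1.
  by apply: plane_eqP; rewrite !mxE !eqxx /= ?mulr0 ?mulr1 ?addr0 ?add0r.
rewrite [in RHS]vE deriveE// linearD !linearZ /= -!deriveE//.
by rewrite dotE !mxE mulrC [X in _ + X]mulrC.
Qed.

Section Construction.
Variables (g : R -> R) (N : nat) (c : R) (P : {poly R}).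
Hypotheses (gc : circular g) (gs : smooth setT g) (N1 : (1 < N)%N).

Definition extension x : R :=
  cutoff (dot x x) * (g (arg x) + c + hump N (dot x x) * P.[g (arg x)])
  + (dot x x - 1 - c).

Lemma smooth_extension : smooth setT extension.
Proof.
(* Expanded as three flat terms plus a polynomial; the powers of |x|^2 from b go into the factor
   [Q]. *)
have E : extension = fun x =>
    flat_term 1 g (fun=> expR 1) x +
    (flat_term 1 (fun=> 1) (fun=> expR 1 * c) x +
    (flat_term 1 (fun t => P.[g t])
       (fun y => expR 1 * (2 / N%:R * (1 + -1 * dot y y ^+ N))) x
    + (dot x x + (- 1 - c)))).
  by apply: funext => x; rewrite /extension /flat_term /cutoff /hump; ring.
rewrite E.
have c1 := smooth_cst; have sq := @smooth_sq R.
apply: smoothD; first exact: smooth_flat_term.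
apply: smoothD; first exact: smooth_flat_term.
apply: smoothD; last by apply: smoothD.
apply: smooth_flat_term.
- by move=> t t' e; rewrite (gc e).
- exact: smooth_horner.
- do 2 apply: smoothM => //; apply: smoothD => //; apply: smoothM => //.
  exact: smoothX.
Qed.

Definition angular_part x : R := cutoff (dot x x) * derive1 g (arg x) *
  (1 + hump N (dot x x) * P^`().[g (arg x)]).

(** The partial derivative in s = |x|^2 rather than in |x|, hence the factor [2 * dot x v] in the
    differential. *)
Definition radial_part x : R :=
  cutoff (dot x x) * ((1 - dot x x) / dot x x ^+ 2 *
     (g (arg x) + c + hump N (dot x x) * P.[g (arg x)])
     - 2 * dot x x ^+ N.-1 * P.[g (arg x)]) + 1.

Lemma is_diff_extension x : x != 0 -> is_diff x extension (fun v =>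
  angular_part x * (cross x v / dot x x) + radial_part x * (2 * dot x v)).
Proof.
move=> x0; have dx := dot_gt0 x0; have dx0 := lt0r_neq0 dx.
have dg := is_diff_arg x0 gc gs.
have dsq := is_diff_sq x.
have dcut := is_diff_comp1 dsq (is_derive_cutoff dx0).
have dhump := is_diff_comp1 dsq (is_derive_hump (dot x x) (ltnW N1)).
have dP := is_diff_comp1 dg (is_derive_poly P (g (arg x))).
have D := is_diff_add
  (is_diff_mul dcut
    (is_diff_add (is_diff_add dg (is_diff_const c x)) (is_diff_mul dhump dP)))
  (is_diff_add (is_diff_add dsq (is_diff_const (-1) x))
    (is_diff_const (- c) x)).
apply: is_diff_eqd D _ => v.
rewrite /angular_part /radial_part; ring.
Qed.

End Construction.

(** The count of critical points is expressed as a covering: besides 0, each comes from a node of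
    [S] through [h], so there are at most 1 + |S|. *)
Lemma extension_few_crit (phi : plane -> R) (S : set plane) :
  smooth setT (angular phi) -> finite_set (circle_crit phi) ->
  (forall p q, circle_crit phi p -> circle_crit phi q ->
    phi p = phi q -> p = q) ->
  S `<=` circle_crit phi ->
  exists f : plane -> R, [/\ smooth setT f,
    forall p, circle p -> f p = phi p,
    forall p, S p -> dot (grad f p) p < 0,
    forall p, circle_crit phi p -> ~ S p -> 0 < dot (grad f p) p &
    exists h : plane -> plane, crit f `<=` [set 0] `|` h @` S].
Proof.
move=> gs fin inj SZ.
set g := angular phi in gs.
have gc : circular g by move=> t t' e; rewrite /g /angular /= e.
have g_arg p : circle p -> g (arg p) = phi p.
  by move=> cp; rewrite /g /angular /= arg_circle.
have crit_circle p : circle_crit phi p -> circle p.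
  by move=> [t _ <-]; exact: circle_pt_circle.
have [c c0 gB] := circular_bounded gc gs.
have [P PS PnS] : exists2 P : {poly R}, (forall p, S p -> P.[phi p] = 1) &
    (forall p, circle_crit phi p -> ~ S p -> P.[phi p] = 0).
  (* [P] interpolates the indicator of the values of phi on [S]; as critical values are distinct, a
     node outside [S] shares no value with one in [S]. *)
  pose s := undup [seq phi p | p <- fset_set (circle_crit phi)].
  have [P PE] := @interpolation _ s
    (fun y => if `[< exists2 p, S p & phi p = y >] then 1 else 0)
    (undup_uniq _).
  have sP p : circle_crit phi p -> phi p \in s.
    by move=> Zp; rewrite mem_undup; apply: map_f; rewrite in_fset_set ?inE.
  exists P => p; last first.
    move=> Zp Sp; rewrite PE ?sP//; case: asboolP => // -[q Sq e].
    by case: Sp; rewrite -(inj q p)//; exact: SZ.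
  by move=> Sp; rewrite PE ?sP//; [case: asboolP => // -[]; exists p|exact: SZ].
have [B B0 PB] := circular_bounded
  (fun t t' (e : circle_pt t = circle_pt t') =>
    congr1 (horner P^`()) (gc t t' e))
  (smooth_horner P^`() gs).
(* N > 2 B gives |b P'(phi)| < 1 on the disk; the two successors also ensure N > 1. *)
pose N := (Num.bound (2 * B)).+2.
have NB : 2 * B < N%:R.
  apply: (lt_trans (archi_boundP _)); first by rewrite mulr_ge0.
  by rewrite ltr_nat.
have N1 : (1 < N)%N by [].
pose f := extension g N c P.
have fs : smooth setT f by exact: smooth_extension.
have fdiff x : differentiable f x by exact: (proj1 (fs 1%N) x I).
have fD x v : x != 0 -> dot (grad f x) v =
    angular_part g N P x * (cross x v / dot x x) +
    radial_part g N c P x * (2 * dot x v).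
  move=> x0; rewrite dot_grad//.
  exact: (is_diff_derive v (is_diff_extension c P gc gs N1 x0)).
have circle_neq0 p : circle p -> p != 0.
  by rewrite /circle /= => pp; rewrite -dot_eq0 pp oner_eq0.
(* On the circle G = 1 and b = 0, so the radial derivative is -2 where P = 1 and 2 where P = 0. *)
have f_circle p : circle p -> dot (grad f p) p = 2 * (1 - 2 * P.[phi p]).
  move=> cp; have pp : dot p p = 1 by exact: cp.
  rewrite fD ?circle_neq0// /radial_part g_arg// pp cutoff1 hump1 !expr1n.
  by rewrite /cross; field.
have gc0 t : 0 <= g t + c.
  by have := gB t; rewrite ler_norml => /andP[h _]; rewrite -lerBlDr sub0r.
have f_ray x : x != 0 -> crit f x ->
   S (circle_pt (arg x)) /\ ray N (g (arg x) + c) (dot x x) = 0.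
  move=> x0 [x1 gx0]; have d0 := dot_gt0 x0.
  have D v : angular_part g N P x * (cross x v / dot x x) +
             radial_part g N c P x * (2 * dot x v) = 0.
    by rewrite -fD// gx0 dotE !mxE !mul0r addr0.
  (* The vanishing gradient is tested on [x], which kills the angular term, and then on [rot90 x],
     which recovers the angular part. *)
  have rad0 : radial_part g N c P x = 0.
    have := D x; rewrite (_ : cross x x = 0); last by rewrite /cross; ring.
    rewrite mul0r mulr0 add0r => /eqP; rewrite mulf_eq0 => /orP[/eqP//|].
    by rewrite mulf_eq0 pnatr_eq0/= gt_eqF.
  have ang0 : angular_part g N P x = 0.
    have := D (rot90 x); rewrite rad0 mul0r addr0.
    rewrite (_ : cross x (rot90 x) = dot x x); last first.
      by rewrite /cross dotE !mxE/=; ring.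
    by rewrite divff ?gt_eqF// mulr1.
  have Zx : circle_crit phi (circle_pt (arg x)).
    exists (arg x) => //=; move/eqP: ang0; rewrite /angular_part.
    rewrite -mulrA mulf_eq0.
    rewrite (gt_eqF (cutoff_gt0 d0)) /= mulf_eq0 => /orP[/eqP//|].
    have /andP[b0 bN] := @hump_itv R N (dot x x) ltac:(by rewrite (ltW d0)).
    suff : `|hump N (dot x x) * P^`().[g (arg x)]| < 1.
      by rewrite ltr_norml addrC addr_eq0 => /andP[+ _] /eqP E; rewrite E ltxx.
    rewrite normrM (ger0_norm b0) (@le_lt_trans _ _ (2 / N%:R * B))//.
      by apply: ler_pM.
    by rewrite mulrAC ltr_pdivrMr ?mul1r// ltr0n.
  have gE : g (arg x) = phi (circle_pt (arg x)) by [].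
  have [Sx|nSx] := pselect (S (circle_pt (arg x))).
    split=> //; move: rad0; rewrite /radial_part gE PS// !mulr1 => r0.
    have cut0 := cutoff_gt0 d0.
    apply: (mulfI (lt0r_neq0 cut0)); rewrite mulr0 -r0 /ray.
    rewrite mulrDr mulfV ?gt_eqF//.
  (* With P = 0 the radial part is a nonnegative quantity plus 1. *)
  suff : 0 < radial_part g N c P x by rewrite rad0 ltxx.
  rewrite /radial_part gE PnS// !mulr0 subr0 addr0 -gE ltr_wpDl//.
  by rewrite !mulr_ge0 ?invr_ge0 ?exprn_ge0 ?subr_ge0 ?(ltW d0)
    ?(ltW (cutoff_gt0 d0)).
exists f; split => //.
- move=> p cp; have pp : dot p p = 1 by exact: cp.
  rewrite /f /extension pp cutoff1 hump1 g_arg//; ring.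
- move=> p Sp; have cp := crit_circle p (SZ p Sp).
  rewrite f_circle// PS//; lra.
- move=> p Zp nSp; have cp := crit_circle p Zp.
  rewrite f_circle// PnS//; lra.
(* [h] picks a nonzero critical point on the ray through [p], with default 0 if there is none. *)
pose h p := xget 0 [set x | x != 0 /\ crit f x /\ circle_pt (arg x) = p].
exists h => x fx.
have [->|x0] := eqVneq x 0; first by left.
right; have [Sx rx] := f_ray x x0 fx.
exists (circle_pt (arg x)) => //.
have [y0 [fy ayx]] : [set x' | x' != 0 /\ crit f x' /\
    circle_pt (arg x') = circle_pt (arg x)] (h (circle_pt (arg x))).
  by apply: (xgetPex 0); exists x.
move: (h _) y0 fy ayx => y y0 fy ayx.
have [_ ry] := f_ray y y0 fy.
have gyx : g (arg y) = g (arg x) by exact: gc.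
rewrite gyx in ry.
have dyx : dot y y = dot x x.
  (* Two critical points on one ray are zeros of the same strictly decreasing function, so their
     distances to 0 agree. *)
  have [dl|dl|//] := ltgtP (dot y y) (dot x x).
    have := ray_decr N1 (gc0 (arg x)) (dot_gt0 y0) dl (proj1 fx).
    by rewrite rx ry ltxx.
  have := ray_decr N1 (gc0 (arg x)) (dot_gt0 x0) dl (proj1 fy).
  by rewrite rx ry ltxx.
by rewrite (polarE x) (polarE y) dyx ayx.
Qed.
End Extension.

(** * Sign change, types of nodes, and counting *)

Section Nodes.
Variable R : realType.
Local Notation plane := 'rV[R]_2.
Implicit Types (x v p : plane).

Lemma grad_opp (f : plane -> R) x : differentiable f x ->
  grad (fun y => - f y) x = - grad f x.
Proof.
move=> fx; apply/rowP => i; rewrite !mxE.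
by rewrite deriveN//; exact: diff_derivable.
Qed.

Lemma crit_opp (f : plane -> R) : (forall x, differentiable f x) ->
  crit (fun y => - f y) = crit f.
Proof.
move=> fd; apply/seteqP; split=> x [xd gx]; split=> //.
  by apply/eqP; rewrite -oppr_eq0 -grad_opp// gx.
by rewrite grad_opp// gx oppr0.
Qed.

Lemma circle_crit_opp (phi : plane -> R) : smooth setT (angular phi) ->
  circle_crit (fun x => - phi x) = circle_crit phi.
Proof.
move=> gs; congr (_ @` _); apply/seteqP.
have E t : derive1 (angular (fun x => - phi x)) t = - derive1 (angular phi) t.
  rewrite !derive1E -deriveN//.
  by apply/derivable1_diffP; exact: (proj1 (gs 1%N) t I).
split=> t /= h; last by rewrite E h oppr0.
by apply: oppr_inj; rewrite -E h oppr0.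
Qed.

(** The construction for - phi and the nodes outside [T], followed by a change of sign: critical
    points stay and radial derivatives are reversed. *)
Lemma extension_few_crit_opp (phi : plane -> R) (T : set plane) :
  smooth setT (angular phi) -> finite_set (circle_crit phi) ->
  (forall p q, circle_crit phi p -> circle_crit phi q ->
    phi p = phi q -> p = q) ->
  exists f : plane -> R, [/\ smooth setT f,
    forall p, circle p -> f p = phi p,
    forall p, circle_crit phi p -> T p -> dot (grad f p) p < 0,
    forall p, circle_crit phi p -> ~ T p -> 0 < dot (grad f p) p &
    exists h : plane -> plane,
      crit f `<=` [set 0] `|` h @` (circle_crit phi `\` T)].
Proof.
move=> gs fin inj.
have Nphi := circle_crit_opp gs.
have [|||| f [fs fphi fneg fpos [h fh]]] :=
  @extension_few_crit R (fun x => - phi x) (circle_crit phi `\` T).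
- exact: smoothN gs.
- by rewrite Nphi.
- by move=> p q; rewrite Nphi => Zp Zq /oppr_inj; exact: inj.
- by rewrite Nphi; exact: subDsetl.
have fd x : differentiable f x by exact: (proj1 (fs 1%N) x I).
have dotN p : dot (grad (fun y => - f y) p) p = - dot (grad f p) p.
  by rewrite grad_opp// !dotE !mxE; ring.
exists (fun x => - f x); split.
- exact: smoothN.
- by move=> p cp; rewrite fphi// opprK.
- move=> p Zp Tp; rewrite dotN oppr_lt0; apply: fpos; first by rewrite Nphi.
  by case.
- by move=> p Zp Tp; rewrite dotN oppr_gt0; exact: fneg.
- by exists h; rewrite crit_opp.
Qed.

Lemma continuous_circle_pt : continuous (@circle_pt R).
Proof.
move=> t; apply/differentiable_continuous/derivable1_diffP/derivable_mxP => i j.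
have [->|->] : j = 0 \/ j = 1.
  by case: j => [[|[|//]] h]; [left|right]; apply/val_inj.
- rewrite (_ : (fun _ => _) = @cos R); first exact: ex_derive.
  by apply: funext => s; rewrite mxE.
- rewrite (_ : (fun _ => _) = @sin R); first exact: ex_derive.
  by apply: funext => s; rewrite mxE.
Qed.

(** Otherwise phi would be constant on an arc around the node, and its second angular derivative
    would vanish there, against nondegeneracy. *)
Lemma locmax_not_locmin (phi : plane -> R) p :
  is_morse phi -> circle_crit phi p ->
  circle_locmax phi p -> ~ circle_locmin phi p.
Proof.
move=> [_ _ nondeg] [t dt <-] pmax pmin.
have gcst : \forall s \near t, angular phi s = cst (phi (circle_pt t)) s.
  have E : \forall q \near circle_pt t, circle q -> phi q = phi (circle_pt t).
    apply: filterS2 pmax pmin => q h1 h2 cq; apply/le_anti.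
    by rewrite h1// h2.
  have E' : \forall s \near t, circle (circle_pt s) ->
      phi (circle_pt s) = phi (circle_pt t) by exact: continuous_circle_pt E.
  by apply: filterS E' => s; apply; exact: circle_pt_circle.
(* Local constancy at [t] passes to all nearby points, so the first derivative vanishes on a
   neighbourhood and can be differentiated again. *)
have d0 : \forall s \near t, derive1 (angular phi) s = cst 0 s.
  apply: filterS (near_join gcst) => s gs.
  by rewrite derive1E (near_eq_derive _ gs) derive_cst.
have /eqP := nondeg t dt; apply.
by rewrite /derive1n /= derive1E (near_eq_derive _ d0) derive_cst.
Qed.

Lemma num_crit_le (f : plane -> R) (h : plane -> plane) (S : set plane) :
  finite_set S -> crit f `<=` [set 0] `|` h @` S ->
  (num_crit f <= (#|` fset_set S|%fset.+1)%:R%:E)%E.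
Proof.
move=> finS sub.
have finT : finite_set ([set 0] `|` h @` S).
  by rewrite finite_setU; split; [exact: finite_set1|exact: finite_image].
have finf := sub_finite_set sub finT.
rewrite /num_crit; case: pselect => // ff.
rewrite lee_fin ler_nat.
apply: (@leq_trans #|` fset_set ([set 0] `|` h @` S)|%fset).
  by apply: fsubset_leq_card; rewrite -fset_set_sub.
rewrite fset_setU//; last exact: finite_image.
rewrite fset_set1 fset_set_image// cardfsU1.
apply: (@leq_add _ _ 1%N); first exact: leq_b1.
exact: leq_imfset_card.
Qed.

End Nodes.

(** * Choice between the two constructions *)

Theorem theorem15p4 (R : realType) (a : ribbon R) :
  (gamma a <= ((num_nodes a)%:R / 2 + 1)%:E)%E.
Proof.
have [gs fin _] := ribbon_morse a.
have inj := @ribbon_distinct _ a.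
set phi := ribbon_fun a in gs fin inj.
set Z := circle_crit phi in fin.
(* The nodes where the prescribed radial derivative is negative: sign -1 at a maximum, sign 1 at a
   minimum. *)
pose inward : set 'rV[R]_2 :=
  [set p | if `[< circle_locmax phi p >] then ribbon_sign a p = -1
           else ribbon_sign a p = 1].
have ext f : smooth setT f -> (forall p, circle p -> f p = phi p) ->
    (forall p, Z p -> inward p -> dot (grad f p) p < 0) ->
    (forall p, Z p -> ~ inward p -> 0 < dot (grad f p) p) ->
    is_extension a f.
  move=> fs fphi fneg fpos; split=> //.
  - by exists setT; split=> //; exact: openT.
  - move=> p Zp pmax; have [sp|sp] := ribbon_signP Zp; rewrite sp.
      rewrite gtr0_sgz//; apply: fpos => //; rewrite /inward /=.
      by case: asboolP => //; rewrite sp.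
    rewrite ltr0_sgz//; apply: fneg => //; rewrite /inward /=.
    by case: asboolP.
  (* [inward] tests for a maximum, so a minimum must first be shown not to be one. *)
  - move=> p Zp pmin; have npmax : ~ circle_locmax phi p.
      by move=> /(locmax_not_locmin (ribbon_morse a) Zp).
    have [sp|sp] := ribbon_signP Zp; rewrite sp.
      rewrite ltr0_sgz//; apply: fneg => //; rewrite /inward /=.
      by case: asboolP.
    rewrite gtr0_sgz//; apply: fpos => //; rewrite /inward /=.
    by case: asboolP => //; rewrite sp.
have finI : finite_set (Z `&` inward) by exact: finite_setIl.
have finD : finite_set (Z `\` inward) by exact: finite_setD.
have cardZ : (num_nodes a =
    #|` fset_set (Z `&` inward)| + #|` fset_set (Z `\` inward)|)%N.
  have -> : Z `\` inward = Z `\` (Z `&` inward) by rewrite setDIr setDv set0U.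
  rewrite /num_nodes -/Z fset_setD//.
  rewrite -(cardfsID (fset_set (Z `&` inward)) (fset_set Z)).
  congr (#|` _| + _)%N; apply/fsetIidPr.
  by rewrite -fset_set_sub.
have conclude (f : 'rV[R]_2 -> R) (h : 'rV[R]_2 -> 'rV[R]_2)
    (S : set 'rV[R]_2) :
    finite_set S -> is_extension a f -> crit f `<=` [set 0] `|` h @` S ->
    (2 * #|` fset_set S| <= num_nodes a)%N ->
    (gamma a <= ((num_nodes a)%:R / 2 + 1)%:E)%E.
  move=> finS fa sub le; apply: (@le_trans _ _ (num_crit f)).
    by apply: ereal_inf_lbound; exists f.
  have L := num_crit_le finS sub.
  apply: (le_trans L).
  rewrite lee_fin -natr1 lerD2r ler_pdivlMr// mulrC -natrM ler_nat//.
have [le|lt] := leqP (2 * #|` fset_set (Z `&` inward)|) (num_nodes a).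
  have [] := @extension_few_crit R phi (Z `&` inward) => //.
  move=> f [fs fphi fneg fpos [h fh]].
  apply: (conclude f h (Z `&` inward)) => //; apply: ext => //.
    by move=> p Zp ip; exact: fneg.
  by move=> p Zp np; apply: fpos => // -[].
have [f [fs fphi fneg fpos [h fh]]] :=
  @extension_few_crit_opp R phi inward gs fin inj.
apply: (conclude f h (Z `\` inward)) => //; first exact: ext.
(* If the inward nodes are more than half of all nodes, they outnumber the others, which are then at
   most half. *)
by move: lt; rewrite cardZ !mul2n -!addnn ltn_add2l leq_add2r => /ltnW.
Qed.
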